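(* Let $G$ be a completely metrizable topological group with identity $e$, let $d$ be a left-invariant compatible metric on $G$, let $\rho$ be a left-invariant continuous pseudometric on $G$, and let $T\colon G\to G$ be a continuous endomorphism of $G$. Then the following assertions are equivalent: (1) $T$ admits a dense set of distributionally irregular points of type $2$; (2) $T$ admits a residual set of distributionally irregular points of type $2$; (3) there exists $\delta>0$ such that for every sequence $(O_j)_{j\in\mathbb{N}}$ of nonempty open subsets of $G$, there exists a sequence $(K_j)_{j\in\mathbb{N}}$ of Cantor sets with $K_j\subset O_j$ such that $\bigcup_{j=1}^\infty K_j$ is distributionally extremely $\delta$-scrambled of type $2$; (4) the distributionally proximal relation of $T$ is dense in $G\times G$ and $T$ is extremely mean-L-unstable.
   Context: A topological group is completely metrizable if its topology is induced by some complete metric. A compatible metric $d$ on $G$ is a metric inducing the topology of $G$ (not required to be complete). A (pseudo)metric $d$ is left-invariant if $d(zx,zy)=d(x,y)$ for all $x,y,z\in G$. A continuous endomorphism is a continuous group homomorphism $G\to G$. $\mathbb{N}$ is the set of positive integers. For $A\subset\mathbb{N}$, $\overline{\mathrm{dens}}(A)=\limsup_{n\to\infty}\frac{\mathrm{card}(A\cap[1,n])}{n}$. A set is residual if it contains a dense $G_\delta$ subset. A Cantor set is a subset homeomorphic to the Cantor ternary set. All ''extreme'' and ''irregular'' notions are with respect to the fixed $\rho$: A point $x\in G$ is distributionally irregular of type $2$ for $T$ if there exists $A\subset\mathbb{N}$ with $\overline{\mathrm{dens}}(A)=1$ such that $\lim_{A\ni n\to\infty}T^nx=e$, and there exists $B\subset\mathbb{N}$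 with $\overline{\mathrm{dens}}(B)>0$ such that $\lim_{B\ni n\to\infty}\rho(T^nx,e)=\infty$. A pair $(x,y)\in G\times G$ is distributionally proximal if for every $\varepsilon>0$, $\overline{\mathrm{dens}}(\{n\in\mathbb{N}:d(T^nx,T^ny)<\varepsilon\})=1$; the distributionally proximal relation is the set of all such pairs. For $\delta>0$, a pair $(x,y)$ is distributionally extremely $\delta$-chaotic of type $2$ if it is distributionally proximal and for any $M>0$, $\overline{\mathrm{dens}}(\{n\in\mathbb{N}:\rho(T^nx,T^ny)>M\})\ge\delta$. A set $K\subset G$ is distributionally extremely $\delta$-scrambled of type $2$ if any two distinct points of $K$ form such a pair. $T$ is extremely mean-L-unstable if there exists $\delta>0$ such that for every $x\in G$ and $\varepsilon>0$ there exists $y\in G$ with $d(x,y)<\varepsilon$ such that for any $M>0$, $\overline{\mathrm{dens}}(\{n\in\mathbb{N}:\rho(T^nx,T^ny)>M\})\ge\delta$. *)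

(* Defs.v *)
From HB Require Import structures.
From mathcomp Require Import all_boot all_order all_algebra.
From mathcomp Require Import finmap.
From mathcomp Require Import boolp classical_sets functions cardinality.
From mathcomp Require Import set_interval reals ereal topology normedtype.
From mathcomp Require Import sequences borel_hierarchy.

Set Implicit Arguments.
Unset Strict Implicit.
Unset Printing Implicit Defensive.

Import Order.TTheory GRing.Theory Num.Theory.
Import numFieldNormedType.Exports.

Local Open Scope classical_set_scope.
Local Open Scope ring_scope.

HB.mixin Record TopologicalGroup_of_Group G
    of Topological G & monoid.Group G := {
  topgroup_mul_continuous : continuous (fun p : G * G => (p.1 * p.2)%g) ;
  topgroup_inv_continuous : continuous (fun x : G => (x^-1)%g)
}.

#[short(type="topologicalGroupType")]
HB.structure Definition TopologicalGroup :=
  {G of Topological G & monoid.Group G & TopologicalGroup_of_Group G}.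

(* The distances are plain functions and not instances of [metricType], because
   several of them live on the same topological space, whose topology is given
   beforehand. *)
Definition pseudometric (R : realType) (X : Type) (d : X -> X -> R) : Prop :=
  [/\ forall x y, 0 <= d x y,
      forall x, d x x = 0,
      forall x y, d x y = d y x &
      forall x y z, d x z <= d x y + d y z].

Definition metric (R : realType) (X : Type) (d : X -> X -> R) : Prop :=
  pseudometric d /\ forall x y, d x y = 0 -> x = y.

Definition induces_topology (R : realType) (X : topologicalType)
    (d : X -> X -> R) : Prop :=
  forall (x : X) (A : set X),
    nbhs x A <-> exists2 e : R, 0 < e & [set y | d x y < e] `<=` A.

Definition compatible_metric (R : realType) (X : topologicalType)
    (d : X -> X -> R) : Prop :=
  metric d /\ induces_topology d.

Definition cauchy_sequence (R : realType) (X : Type) (d : X -> X -> R)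
    (u : nat -> X) : Prop :=
  forall e : R, 0 < e ->
    exists N : nat, forall m n : nat, (N <= m)%N -> (N <= n)%N ->
      d (u m) (u n) < e.

Definition complete_metric (R : realType) (X : Type) (d : X -> X -> R) : Prop :=
  forall u : nat -> X, cauchy_sequence d u ->
    exists l : X, d (u n) l @[n --> \oo] --> (0 : R).

Definition completely_metrizable (R : realType) (X : topologicalType) : Prop :=
  exists d : X -> X -> R, compatible_metric d /\ complete_metric d.

Definition left_invariant (R : realType) (G : groupType) (d : G -> G -> R)
    : Prop :=
  forall x y z : G, d (z * x)%g (z * y)%g = d x y.

Definition residual (X : topologicalType) (S : set X) : Prop :=
  exists A : set X, [/\ Gdelta A, dense A & A `<=` S].

(* Only the positive elements of [A] are counted; the (junk) term of index 0 is
   irrelevant to the limit superior. *)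
Definition upper_density (R : realType) (A : set nat) : \bar R :=
  limn_esup (fun n : nat =>
    ((#|` fset_set (A `&` [set k | (1 <= k <= n)%N])|%fset)%:R / n%:R : R)%:E).

Fixpoint cantor_stage {R : realType} (n : nat) : set R :=
  if n is m.+1 then
    [set x / 3 | x in cantor_stage m] `|`
    [set (x + 2) / 3 | x in cantor_stage m]
  else [set x | 0 <= x <= 1].

Definition cantor_ternary_set (R : realType) : set R :=
  \bigcap_n (cantor_stage n : set R).

Definition homeomorphic (X Y : topologicalType) (A : set X) (B : set Y)
    : Prop :=
  exists (f : X -> Y) (g : Y -> X),
    [/\ {within A, continuous f}, {within B, continuous g},
        {homo f : x / A x >-> B x}, {homo g : y / B y >-> A y} &
        (forall x, A x -> g (f x) = x) /\ (forall y, B y -> f (g y) = y)].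

Definition cantor_set (R : realType) (X : topologicalType) (K : set X) : Prop :=
  homeomorphic K (@cantor_ternary_set R).

Section Dynamics.
Context (R : realType) (G : topologicalGroupType).
Variables (d rho : G -> G -> R) (T : G -> G).

(* [within A \oo] is the filter of "n tends to infinity along A". *)
Definition distr_irregular2 (x : G) : Prop :=
  (exists A : set nat, upper_density R A = 1%E /\
     iter n T x @[n --> within A \oo] --> (1%g : G)) /\
  (exists B : set nat, (0 < upper_density R B)%E /\
     rho (iter n T x) 1%g @[n --> within B \oo] --> +oo).

Definition distr_proximal (x y : G) : Prop :=
  forall e : R, 0 < e ->
    upper_density R [set n | d (iter n T x) (iter n T y) < e] = 1%E.

Definition distr_proximal_relation : set (G * G) :=
  [set p | distr_proximal p.1 p.2].

Definition far_apart (delta : R) (x y : G) : Prop :=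
  forall M : R, 0 < M ->
    (delta%:E <=
       upper_density R [set n | (M < rho (iter n T x) (iter n T y))%R])%E.

Definition distr_extremely_chaotic2 (delta : R) (x y : G) : Prop :=
  distr_proximal x y /\ far_apart delta x y.

Definition distr_extremely_scrambled2 (delta : R) (K : set G) : Prop :=
  forall x y, K x -> K y -> x <> y -> distr_extremely_chaotic2 delta x y.

Definition extremely_mean_L_unstable : Prop :=
  exists2 delta : R, 0 < delta &
    forall (x : G) (e : R), 0 < e ->
      exists2 y : G, d x y < e & far_apart delta x y.

End Dynamics.

(* Main.v *)
Require Import Defs.
From HB Require Import structures.
From mathcomp Require Import all_boot all_order all_algebra finmap.
From mathcomp Require Import boolp classical_sets functions cardinality.
From mathcomp Require Import reals ereal topology normedtype sequences.
From mathcomp Require Import borel_hierarchy ring lra.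

Set Implicit Arguments.
Unset Strict Implicit.
Unset Printing Implicit Defensive.

Import Order.TTheory GRing.Theory Num.Theory.
Import numFieldNormedType.Exports.

Local Open Scope classical_set_scope.
Local Open Scope ring_scope.

(** Left invariance turns a pair [(x, y)] into the single point [x^-1 * y]: both
    distances between the orbits of [x] and [y] are the distances from the orbit
    of [x^-1 * y] to the identity.  So everything is governed by two sets, the
    points proximal to the identity and the points whose orbit is [rho]-far from
    the identity with upper density at least [delta].

    Each of them is a decreasing intersection of open sets ([prox_level],
    [far_level]), because asking that some finite proportion of the first [n]
    iterates lies in an open set is an open condition.  All four assertions
    amount to the density of these open sets for one [delta > 0]
    ([generic_instability]).

    The uniform [delta] comes from one irregular point [x0].  Since [x0] is
    proximal to the identity, some iterate [w] of [x0] is arbitrarily close to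
    it, and [w] is as far from the identity, in density, as [x0] is; hence every
    [x] has the neighbour [x * w], far from [x] with the density of [x0].  That
    is the instability in the fourth assertion.  Conversely, when [x] and [y]
    are far apart, one of them is far from the identity with half the density
    ([far_apart_split]), so instability makes the sets [far_level] dense; the
    sets [prox_level] are dense because the proximal relation is.

    Once these open sets are dense, the Baire property gives a residual set of
    points lying in all of them, and a diagonal choice of times
    ([frequent_pseudo_intersection]) shows that such points are irregular.  The
    scrambled Cantor sets come from a Mycielski-type construction
    ([generic_branches]): open sets indexed by finite binary words are refined
    so that any two distinct words of the same length are separated by the
    dense open relations [x^-1 * y \in prox_level k /\ far_level k].  Its
    branches form copies of the Cantor space, which [ternary] identifies with
    the Cantor ternary set.  From two points of a scrambled Cantor set inside a
    small ball, [far_apart_split] recovers the instability. *)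

(** * Counting and upper density *)

Definition cnt (A : set nat) (n : nat) : nat :=
  count (fun i => `[< A i >]) (iota 1 n).

(** Elementary counterpart of an upper density at least [c]; the strict inequality
    at infinitely many [n] is what makes the level sets below open. *)
Definition frequent (R : realType) (A : set nat) (c : R) : Prop :=
  forall N, exists2 n, (N <= n)%N & c * n%:R < (cnt A n)%:R.

Lemma card_fset_set_cnt (A : set nat) n :
  #|` fset_set (A `&` [set k | (1 <= k <= n)%N])|%fset = cnt A n.
Proof.
rewrite /cnt -size_filter.
set s := seq.filter _ _.
have -> : A `&` [set k | (1 <= k <= n)%N] = [set` [fset x in s]%fset].
  apply/seteqP; split => k /=; rewrite !inE /= mem_filter mem_iota add1n ltnS.
    by move=> [Ak ->]; rewrite andbT; apply/asboolP.
  by move=> /andP[/asboolP].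
by rewrite set_fsetK card_fseq undup_id // filter_uniq // iota_uniq.
Qed.

Lemma cnt_sub_le (A B : set nat) n :
  (forall i, (i <= n)%N -> A i -> B i) -> (cnt A n <= cnt B n)%N.
Proof.
move=> AB; rewrite /cnt -!size_filter.
have -> : [seq i <- iota 1 n | `[< A i >]] =
          [seq i <- [seq i <- iota 1 n | `[< B i >]] | `[< A i >]].
  rewrite -filter_predI; apply: eq_in_filter => i.
  rewrite mem_iota add1n ltnS => /andP[_ /AB ABi] /=.
  by case: asboolP => //= /ABi ?; apply/esym/asboolP.
by rewrite size_filter count_size.
Qed.

Lemma cnt_sub (A B : set nat) n : A `<=` B -> (cnt A n <= cnt B n)%N.
Proof. by move=> AB; apply: cnt_sub_le => i _; exact: AB. Qed.

Lemma cnt_le (A : set nat) n : (cnt A n <= n)%N.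
Proof. by rewrite (leq_trans (count_size _ _)) // size_iota. Qed.

Lemma cntU (A B : set nat) n : (cnt (A `|` B) n <= cnt A n + cnt B n)%N.
Proof.
rewrite /cnt -count_predUI (leq_trans _ (leq_addr _ _)) //.
apply: sub_count => i /asboolP ABi /=; apply/orP.
by case: ABi => ?; [left|right]; apply/asboolP.
Qed.

Lemma cnt_gt0 (A : set nat) n : (0 < cnt A n)%N -> A !=set0.
Proof. by rewrite -has_count => /hasP[i _ /asboolP Ai]; exists i. Qed.

Lemma cnt_initial (N n : nat) : (cnt [set i | (i <= N)%N] n <= N)%N.
Proof.
have [nN|Nn] := leqP n N; first exact: leq_trans (cnt_le _ _) nN.
rewrite /cnt -(subnKC (ltnW Nn)) iotaD count_cat.
rewrite (_ : count _ (iota (1 + N) _) = 0%N).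
  by rewrite addn0 (leq_trans (count_size _ _)) // size_iota.
apply/eqP; rewrite -leqn0 leqNgt -has_count; apply/hasP => -[i].
by rewrite mem_iota => /andP[+ _] /asboolP /=; rewrite add1n ltnNge => /negP.
Qed.

(** Shifting a set of times loses at most [m] of them, hence no density. *)
Lemma cnt_shift (A : set nat) m n :
  (cnt A n <= cnt [set i | A (m + i)%N] n + m)%N.
Proof.
have [nm|mn] := leqP n m.
  by rewrite (leq_trans (cnt_le _ _)) // (leq_trans nm) // leq_addl.
rewrite -{1}(subnKC (ltnW mn)) /cnt iotaD count_cat addnC leq_add //.
  rewrite (_ : iota 1 n = iota 1 ((n - m) + m)); last by rewrite subnK // ltnW.
  rewrite iotaD count_cat (leq_trans _ (leq_addr _ _)) //.
  rewrite [(1 + m)%N]addnC iotaDl count_map.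
  by apply: sub_count => i.
by rewrite (leq_trans (count_size _ _)) // size_iota.
Qed.

Section Density.
Context {R : realType}.
Implicit Types (A B : set nat) (c : R).

Lemma frequent_finite_defect A B (m : nat) c c' : c' < c ->
    (forall n, (cnt A n <= cnt B n + m)%N) ->
  frequent A c -> frequent B c'.
Proof.
move=> cc' AB Ac N.
(* Beyond [m / (c - c')], the loss of [m] elements is paid by lowering [c]. *)
pose K := (Num.bound (m%:R / (c - c'))).
have [n] := Ac (maxn N K); rewrite geq_max => /andP[Nn Kn] lt_c.
exists n => //.
have : m%:R / (c - c') < n%:R.
  apply: (@lt_le_trans _ _ K%:R); last by rewrite ler_nat.
  by rewrite archi_boundP // divr_ge0 // subr_ge0 ltW.
rewrite ltr_pdivrMr ?subr_gt0 // => m_lt.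
have := AB n; rewrite -(ler_nat R) natrD => AB'; nra.
Qed.

Lemma frequent_lt_upper_density A c :
  (c%:E < upper_density R A)%E -> frequent A c.
Proof.
move=> lt_c N.
have /(lt_le_trans lt_c) : (upper_density R A <=
    ereal_sup ((fun n => (#|` fset_set (A `&` [set k | (1 <= k <= n)%N])|%fset%:R
       / n%:R : R)%:E) @` [set n | (N.+1 <= n)%N]))%E.
  apply: ereal_inf_lbound; exists [set n | (N.+1 <= n)%N] => //.
  exact: nbhs_infty_ge.
move=> /ereal_sup_gt[_ [n /= Nn <-]]; rewrite lte_fin card_fset_set_cnt => lt_cn.
exists n; first exact: ltnW.
by rewrite -ltr_pdivlMr // ltr0n; apply: leq_trans Nn.
Qed.

Lemma frequent_le_upper_density A c :
  frequent A c -> (c%:E <= upper_density R A)%E.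
Proof.
move=> Ac; apply: le_ereal_inf_tmp => _ [V [N _ NV] <-].
have [n Nn lt_c] := Ac N.+1.
apply: le_trans (ereal_sup_ubound _); last first.
  by exists n => //; apply: NV; apply: ltnW.
rewrite lee_fin card_fset_set_cnt ler_pdivlMr ?ltW //.
by rewrite ltr0n; apply: leq_trans Nn.
Qed.

Lemma upper_density_geP A (delta : R) :
  (delta%:E <= upper_density R A)%E <-> forall c, c < delta -> frequent A c.
Proof.
split=> [Ad c cd|Ad].
  by apply: frequent_lt_upper_density; apply: lt_le_trans Ad; rewrite lte_fin.
have {}Ad c : c < delta -> (c%:E <= upper_density R A)%E.
  by move=> /Ad/frequent_le_upper_density.
case: (upper_density R A) Ad => [r| |] Ad; rewrite ?leey //.
  rewrite lee_fin leNgt; apply/negP => rd.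
  have /Ad : (r + delta) / 2 < delta by lra.
  by rewrite lee_fin; lra.
by have := Ad (delta - 1); rewrite ltrBlDr ltrDl ltr01 leeNy_eq => /(_ isT).
Qed.

Lemma upper_density_le1 A : (upper_density R A <= 1)%E.
Proof.
rewrite leNgt; apply/negP => /frequent_lt_upper_density -/(_ 0%N)[n _].
by rewrite mul1r ltr_nat ltnNge cnt_le.
Qed.

Lemma upper_density_eq1P A :
  upper_density R A = 1%E <-> forall c : R, c < 1 -> frequent A c.
Proof.
rewrite -upper_density_geP; split => [->//|le1].
by apply/eqP; rewrite eq_le upper_density_le1.
Qed.

Lemma upper_density_gt0P A :
  (0 < upper_density R A)%E <-> exists2 c : R, 0 < c & frequent A c.
Proof.
split=> [|[c c0 /frequent_le_upper_density]]; last first.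
  by apply: lt_le_trans; rewrite lte_fin.
move=> A0; have [r r0 rA] : exists2 r : R, 0 < r & (r%:E < upper_density R A)%E.
  move: A0; case: (upper_density R A) => [r| |] //.
    by rewrite lte_fin => r0; exists (r / 2); rewrite ?lte_fin; lra.
  by exists 1 => //; rewrite ltry.
by exists r => //; apply: frequent_lt_upper_density.
Qed.

Lemma frequent_eventually_sub A B c c' : c' < c ->
    (\forall n \near \oo, A n -> B n) -> frequent A c -> frequent B c'.
Proof.
move=> cc' [N _ AB]; apply: (@frequent_finite_defect A B N _ _ cc') => n.
apply: leq_trans (leq_add (leqnn _) (cnt_initial N n)).
apply: leq_trans (cntU B [set i | (i <= N)%N] n); apply: cnt_sub => i Ai.
have [iN|Ni] := leqP i N; [by right|left].
by apply: AB => //=; exact: ltnW.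
Qed.

Lemma natSV_lt (e : R) : 0 < e ->
  exists k0 : nat, forall k, (k0 <= k)%N -> k.+1%:R^-1 < e.
Proof.
move=> e0; exists (Num.bound e^-1) => k k0k.
rewrite invf_plt ?posrE //.
apply: (@lt_le_trans _ _ (Num.bound e^-1)%:R); last by rewrite ler_nat leqW.
by rewrite archi_boundP // invr_ge0 ltW.
Qed.

(** Diagonalization.  The set [B] follows [A k] between the times [t k] and
    [t k.+1], where [t k.+1] witnesses the frequency of [A k].  Up to time
    [t k.+1] only the sets [A j] with [j <= k] have been imposed, and they contain
    [A k], so no density is lost. *)
Lemma frequent_pseudo_intersection (A : nat -> set nat) (c : nat -> R) :
    (forall k, A k.+1 `<=` A k) -> (forall k, frequent (A k) (c k)) ->
  exists B : set nat,
    (forall k, exists N, forall n, (N < n)%N -> B n -> A k n) /\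
    (forall k, exists2 n, (k <= n)%N & c k * n%:R < (cnt B n)%:R).
Proof.
move=> A_dec Ac.
have /choice[f fP] (kN : nat * nat) : exists n : nat,
    (kN.2 <= n)%N /\ c kN.1 * n%:R < (cnt (A kN.1) n)%:R.
  by have [n ? ?] := Ac kN.1 kN.2; exists n.
pose t := fix t k := if k is l.+1 then f (l, maxn l (t l).+1) else 0%N.
have tS k : [/\ (k <= t k.+1)%N, (t k < t k.+1)%N &
    c k * (t k.+1)%:R < (cnt (A k) (t k.+1))%:R].
  by have [/=] := fP (k, maxn k (t k).+1); rewrite geq_max => /andP[].
have t_mono j k : (j <= k)%N -> (t j <= t k)%N.
  apply: (homo_leq (r := fun a b => (a <= b)%N)) => // [x y z|i].
    exact: leq_trans.
  by case: (tS i) => _ /ltnW.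
have A_mono j k : (j <= k)%N -> A k `<=` A j.
  move=> jk; apply: (@homo_leq _ _ (fun X Y : set nat => Y `<=` X) _ _ A_dec j k jk) => [X|Y X Z XY YZ].
    exact: subset_refl.
  exact: subset_trans YZ XY.
(* Stating [B] with all past times [t j] avoids locating [n] between two of them. *)
exists [set n | forall j, (t j < n)%N -> A j n]; split => k.
  by exists (t k) => n nk Bn; apply: Bn.
have [kt _ lt_c] := tS k; exists (t k.+1) => //.
apply: lt_le_trans lt_c _; rewrite ler_nat; apply: cnt_sub_le => i ik Ai j /= ji.
apply: A_mono Ai; rewrite leqNgt; apply/negP => /t_mono kj.
by move: (leq_trans (leq_ltn_trans kj ji) ik); rewrite ltnn.
Qed.

End Density.

(** * The Cantor ternary set as a space of binary sequences *)

(** Topological embeddings of the Cantor space, expressed with its basic open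
    sets, the cylinders of sequences with a given prefix. *)
Definition binary_embedding (X : topologicalType) (x : (nat -> bool) -> X) :=
  (forall s A, nbhs (x s) A ->
    exists n, forall s', (forall i, (i < n)%N -> s i = s' i) -> A (x s')) /\
  (forall s n, exists2 A, nbhs (x s) A &
    forall s', A (x s') -> forall i, (i < n)%N -> s i = s' i).

Lemma binary_embedding_transfer (X Y : topologicalType)
    (x : (nat -> bool) -> X) (y : (nat -> bool) -> Y) :
    binary_embedding x -> binary_embedding y ->
  exists f : X -> Y, (forall s, f (x s) = y s) /\
    {within range x, continuous f}.
Proof.
move=> [_ xE] [yC _].
have /choice[r rP] (p : X) : exists s, range x p -> x s = p.
  have [[s _ <-]|nxp] := pselect (range x p); first by exists s.
  by exists (fun=> false).
have rx s : r (x s) = s.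
  apply: funext => i; have [A /nbhs_singleton Axs AP] := xE s i.+1.
  by apply/esym/AP => //; rewrite rP //; exists s.
exists (y \o r); split=> [s|]; first by rewrite /= rx.
apply/subspace_continuousP => _ [s _ <-] A.
rewrite /from_subspace /= rx.
move=> /yC[n nA].
have [B sB BP] := xE s n; rewrite nbhs_simpl /=.
apply: filterS sB => p + [s' _ s'p]; rewrite -s'p /= rx => Bs'.
by apply: nA; apply: BP.
Qed.

Lemma binary_embedding_homeomorphic (X Y : topologicalType)
    (x : (nat -> bool) -> X) (y : (nat -> bool) -> Y) :
  binary_embedding x -> binary_embedding y -> homeomorphic (range x) (range y).
Proof.
move=> xE yE.
have [f [fx cf]] := binary_embedding_transfer xE yE.
have [g [gy cg]] := binary_embedding_transfer yE xE.
exists f, g; split => //.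
- by move=> _ [s _ <-]; rewrite fx; exists s.
- by move=> _ [s _ <-]; rewrite gy; exists s.
- by split=> _ [s _ <-]; rewrite ?fx ?gy ?fx.
Qed.

Section TernaryExpansion.
Context {R : realType}.
Implicit Types (s : nat -> bool) (p q : R).

Definition shift s : nat -> bool := fun i => s i.+1.

Definition digit (b : bool) : R := if b then 2 else 0.

Fixpoint ternary_sum n s : R :=
  if n is m.+1 then (ternary_sum m (shift s) + digit (s 0%N)) / 3 else 0.

(** The sum of the series of the [digit (s i) / 3 ^+ i.+1], obtained without any
    convergence argument since its partial sums increase. *)
Definition ternary s : R := sup (range (ternary_sum ^~ s)).

Lemma ternary_sum_ge0 n s : 0 <= ternary_sum n s.
Proof.
elim: n s => //= n IHn s; have := IHn (shift s); rewrite /digit.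
by case: (s 0%N) => ?; lra.
Qed.

Lemma ternary_sum_le1 n s : ternary_sum n s <= 1.
Proof.
elim: n s => //= n IHn s; have := IHn (shift s); rewrite /digit.
by case: (s 0%N) => ?; lra.
Qed.

Lemma ternary_sum_leS n s : ternary_sum n s <= ternary_sum n.+1 s.
Proof.
elim: n s => [|n IHn] s; first exact: ternary_sum_ge0.
by have := IHn (shift s) => /= ?; rewrite ler_pM2r ?invr_gt0 // lerD2r.
Qed.

Lemma ternary_sum_has_sup s : has_sup (range (ternary_sum ^~ s)).
Proof.
split; first by exists (ternary_sum 0 s), 0%N.
by exists 1 => _ [n _ <-]; exact: ternary_sum_le1.
Qed.

Lemma ternary_le s p : (forall n, ternary_sum n s <= p) -> ternary s <= p.
Proof.
move=> sp; apply: ge_sup => [|_ [n _ <-] //].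
by exists (ternary_sum 0 s), 0%N.
Qed.

Lemma ternary_sum_le n s : ternary_sum n s <= ternary s.
Proof. by apply: ub_le_sup; [case: (ternary_sum_has_sup s)|exists n]. Qed.

Lemma ternaryE s : ternary s = (ternary (shift s) + digit (s 0%N)) / 3.
Proof.
apply/eqP; rewrite eq_le; apply/andP; split.
  apply: ternary_le => n; apply: le_trans (ternary_sum_leS n s) _ => /=.
  by rewrite ler_pM2r ?invr_gt0 // lerD2r ternary_sum_le.
rewrite ler_pdivrMr // -lerBrDr; apply: ternary_le => n.
by have /= := ternary_sum_le n.+1 s; lra.
Qed.

Lemma ternary_ge0 s : 0 <= ternary s.
Proof. exact: (ternary_sum_le 0 s). Qed.

Lemma ternary_le1 s : ternary s <= 1.
Proof. by apply: ternary_le => n; exact: ternary_sum_le1. Qed.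

Lemma ternary_cantor s : cantor_ternary_set (ternary s).
Proof.
move=> n _; elim: n s => [|n IHn] s /=.
  by rewrite ternary_ge0 ternary_le1.
rewrite ternaryE /digit; case: (s 0%N); [right|left].
  by exists (ternary (shift s)).
by exists (ternary (shift s)); rewrite ?addr0.
Qed.

Lemma ternary_near n s s' :
  (forall i, (i < n)%N -> s i = s' i) -> `|ternary s - ternary s'| <= 3 ^- n.
Proof.
elim: n s s' => [|n IHn] s s' ss'.
  have := ternary_ge0 s; have := ternary_ge0 s'.
  have := ternary_le1 s; have := ternary_le1 s'.
  by rewrite expr0 invr1 ler_norml => *; apply/andP; split; lra.
have /IHn : forall i, (i < n)%N -> shift s i = shift s' i by move=> i /(ss' i.+1).
rewrite (ternaryE s) (ternaryE s') ss' // exprS invfM.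
rewrite -mulrBl opprD addrACA subrr addr0 normrM mulrC => IH.
by rewrite ler_pM // ger0_norm // invr_ge0.
Qed.

(** The first digit decides between the two outer thirds, which are [1 / 3] apart;
    each further digit is read after a dilation by [3]. *)
Lemma ternary_far n s s' : `|ternary s - ternary s'| < 3 ^- n ->
  forall i, (i < n)%N -> s i = s' i.
Proof.
elim: n s s' => // n IHn s s' lt_ss'.
have ss0 : s 0%N = s' 0%N.
  have : `|ternary s - ternary s'| < 3^-1.
    apply: lt_le_trans lt_ss' _; rewrite exprS invfM ler_piMr ?invr_ge0 //.
    by rewrite invf_le1 ?exprn_gt0 // exprn_ege1 // ler1n.
  have := ternary_ge0 (shift s); have := ternary_ge0 (shift s').
  have := ternary_le1 (shift s); have := ternary_le1 (shift s').
  rewrite (ternaryE s) (ternaryE s') /digit ltr_norml.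
  by case: (s 0%N) (s' 0%N) => -[] // * ; lra.
case=> // i; apply: (IHn (shift s) (shift s')).
move: lt_ss'; rewrite (ternaryE s) (ternaryE s') ss0 exprS invfM.
rewrite -mulrBl opprD addrACA subrr addr0 normrM mulrC.
by rewrite [X in X * _ < _]ger0_norm ?invr_ge0 // ltr_pM2l ?invr_gt0.
Qed.

Lemma expr3V_lt (e : R) : 0 < e -> exists n, 3 ^- n < e.
Proof.
move=> e0; exists (Num.bound e^-1).
have eb : e^-1 < (Num.bound e^-1)%:R by rewrite archi_boundP // invr_ge0 ltW.
rewrite invf_plt ?posrE ?exprn_gt0 //; apply: lt_trans eb _.
by rewrite -natrX ltr_nat ltn_expl.
Qed.

Lemma ternary_embedding : binary_embedding (ternary : (nat -> bool) -> R).
Proof.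
split=> [s A|s n].
  move=> /nbhs_ballP[e /= e0 eA]; have [n ne] := expr3V_lt e0.
  by exists n => s' ss'; apply: eA; apply: le_lt_trans ne; exact: ternary_near.
exists (ball (ternary s) (3 ^- n)); last by move=> s'; exact: ternary_far.
by apply: nbhsx_ballx; rewrite invr_gt0 exprn_gt0.
Qed.

(** Which of the two maps produces [p] at a stage is decided by the position of
    [p] relative to [1 / 2], so it is the same at all stages, and the remaining
    point [bq.2] lies in every stage as well. *)
Lemma cantor_digit p : cantor_ternary_set p ->
  exists bq : bool * R, p = (bq.2 + digit bq.1) / 3 /\ cantor_ternary_set bq.2.
Proof.
move=> Cp.
have stage01 n q : cantor_stage n q -> 0 <= q <= 1.
  elim: n q => //= n IHn q [] [r /IHn r01 <-]; lra.
have [p_small|p_big] := leP p (1 / 2).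
  exists (false, 3 * p); split => /=; first by rewrite /digit; field.
  move=> n _; have [] := Cp n.+1 I => -[r Cr rp]; first by rewrite -rp mulrC divfK.
  by have := stage01 _ _ Cr; rewrite -rp in p_small; lra.
exists (true, 3 * p - 2); split => /=; first by rewrite /digit; field.
move=> n _; have [] := Cp n.+1 I => -[r Cr rp].
  by have := stage01 _ _ Cr; rewrite -rp in p_big; lra.
by rewrite -rp mulrC divfK // addrK.
Qed.

Lemma range_ternary : range ternary = @cantor_ternary_set R.
Proof.
apply/seteqP; split => [_ [s _ <-]|p Cp]; first exact: ternary_cantor.
pose C := {q : R | cantor_ternary_set q}.
pose q0 : C := exist _ p Cp.
have /choice[f fP] (q : C) : exists br : bool * C,
      sval q = (sval br.2 + digit br.1) / 3.
  by have [[b r] /= [qE Cr]] := cantor_digit (svalP q); exists (b, exist _ r Cr).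
pose orb (q : C) i := iter i (fun r : C => (f r).2) q.
pose s (q : C) i := (f (orb q i)).1.
have near_s n (q : C) : `|sval q - ternary (s q)| <= 3 ^- n.
  elim: n q => [|n IHn] q.
    have := ternary_ge0 (s q); have := ternary_le1 (s q).
    have /= /andP[] := svalP q 0%N I.
    by rewrite expr0 invr1 ler_norml => *; apply/andP; split; lra.
  rewrite ternaryE fP (_ : shift (s q) = s (f q).2); last first.
    by apply: funext => i; rewrite /shift /s /orb iterSr.
  rewrite -mulrBl opprD addrACA subrr addr0 normrM mulrC exprS invfM.
  by rewrite ler_pM // ger0_norm // invr_ge0.
exists (s q0) => //; apply/eqP; rewrite eq_sym -subr_eq0 -normr_le0 leNgt.
apply/negP => /expr3V_lt[n]; apply/negP; rewrite -leNgt; exact: (near_s n q0).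
Qed.

End TernaryExpansion.

Lemma binary_embedding_cantor_set (R : realType) (X : topologicalType)
    (x : (nat -> bool) -> X) :
  binary_embedding x -> cantor_set R (range x).
Proof.
move=> xE; rewrite /cantor_set -range_ternary.
exact: binary_embedding_homeomorphic xE ternary_embedding.
Qed.

Lemma cantor_set_two_points (R : realType) (X : topologicalType) (K : set X) :
  cantor_set R K -> exists x y, [/\ K x, K y & x <> y].
Proof.
move=> [f [g [_ _ _ gK [_ fg]]]].
have C0 := ternary_cantor (R := R) (fun=> false).
have C1 := ternary_cantor (R := R) (fun=> true).
exists (g (ternary (fun=> false))), (g (ternary (fun=> true))).
split; [exact: gK|exact: gK|move=> /(congr1 f)].
rewrite !fg // => eq01.
have : `|ternary (fun=> false) - ternary (fun=> true)| < 3 ^- 1 :> R.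
  by rewrite eq01 subrr normr0 invr_gt0.
by move=> /ternary_far/(_ 0%N isT).
Qed.

(** * Cantor schemes generic for a sequence of dense open relations *)

Section CompatibleMetric.
Context {R : realType} {X : topologicalType} {D : X -> X -> R}.
Hypothesis D_compat : compatible_metric D.

Let D_refl x : D x x = 0.
Proof. by case: D_compat => [[[]]]. Qed.

Let D_sym x y : D x y = D y x.
Proof. by case: D_compat => [[[]]]. Qed.

Let D_tri x y z : D x z <= D x y + D y z.
Proof. by case: D_compat => [[[]]]. Qed.

Lemma nbhs_metric_ball x e : 0 < e -> nbhs x [set y | D x y < e].
Proof. by case: D_compat => _ D_top e0; apply/D_top; exists e. Qed.

Lemma open_metric_ball x e : open [set y | D x y < e].
Proof.
rewrite openE => y /= xy; rewrite /interior.
apply: filterS (@nbhs_metric_ball y (e - D x y) _); last by rewrite subr_gt0.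
by move=> z /=; rewrite ltrBrDl; apply: le_lt_trans.
Qed.

Lemma metric_ball_sub (A : set X) x : open A -> A x ->
  exists2 e, 0 < e & [set y | D x y < e] `<=` A.
Proof. by case: D_compat => _ D_top oA Ax; apply/D_top; exact: open_nbhs_nbhs. Qed.

(** Inclusion of the closure, not just of the set, makes the limits of the scheme
    belong to all its levels. *)
Lemma shrink_open (U : set X) (e : R) : 0 < e -> open U -> U !=set0 ->
  exists V : set X, [/\ open V, V !=set0, closure V `<=` U &
    forall y z, V y -> V z -> D y z < e].
Proof.
move=> e0 oU [x Ux]; have [r r0 rU] := metric_ball_sub oU Ux.
pose t := Num.min r e / 2.
have t0 : 0 < t by rewrite divr_gt0 // lt_min r0.
have [tr te] : t <= r / 2 /\ t <= e / 2.
  by rewrite /t; split; rewrite ler_pM2r ?invr_gt0 // ge_min lexx ?orbT.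
exists [set y | D x y < t]; split.
- exact: open_metric_ball.
- by exists x; rewrite /= D_refl.
- move=> y /(_ _ (@nbhs_metric_ball y t t0))[z [/= xz yz]]; apply: rU => /=.
  by have := D_tri x z y; rewrite (D_sym z y); lra.
- by move=> y z /= xy xz; have := D_tri y x z; rewrite (D_sym y x); lra.
Qed.

Lemma limit_in_closure (u : nat -> X) l (V : set X) N :
  D (u n) l @[n --> \oo] --> 0 -> (forall n, (N <= n)%N -> V (u n)) ->
  closure V l.
Proof.
move=> ul Vu B; case: D_compat => _ D_top /D_top[e e0 eB].
have /cvgrPdist_lt/(_ _ e0)[M _ uM] := ul.
exists (u (maxn N M)); split; first by apply: Vu; exact: leq_maxl.
apply: eB => /=; have := uM (maxn N M) (leq_maxr _ _).
rewrite /= sub0r normrN D_sym => /(le_lt_trans _); apply; exact: ler_norm.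
Qed.

End CompatibleMetric.

Section Refinement.
Context {X : topologicalType} {I : eqType}.
Implicit Types U V : I -> set X.

Definition nonempty_open_family U := forall i, open (U i) /\ U i !=set0.

Lemma refine_pair (W : set (X * X)) U i j : open W -> dense W -> i != j ->
    nonempty_open_family U ->
  exists V, [/\ nonempty_open_family V, forall k, V k `<=` U k &
    V i `*` V j `<=` W].
Proof.
move=> oW dW ij Uo; have [oi [xi Ui]] := Uo i; have [oj [xj Uj]] := Uo j.
have : open (U i `*` U j).
  rewrite openE => -[y z] [/= Uy Uz]; exists (U i, U j) => //=.
  by split; exact: open_nbhs_nbhs.
move=> /(dW _ (ex_intro _ (xi, xj) (conj Ui Uj)))[[y z] [[/= Uy Uz] Wyz]].
have : nbhs (y, z) W by exact: open_nbhs_nbhs.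
case=> -[A B] /= [Ay Bz] ABW.
have /nbhs_interior Ay' := Ay; have /nbhs_interior Bz' := Bz.
pose V k := if k == i then U i `&` A^° else if k == j then U j `&` B^° else U k.
have Vi : V i = U i `&` A^° by rewrite /V eqxx.
have Vj : V j = U j `&` B^° by rewrite /V eq_sym (negbTE ij) eqxx.
exists V; split.
- move=> k; rewrite /V; case: eqP => _; last case: eqP => _; last exact: Uo.
    split; first by apply: openI => //; exact: open_interior.
    by exists y; split => //; exact: nbhs_singleton.
  split; first by apply: openI => //; exact: open_interior.
  by exists z; split => //; exact: nbhs_singleton.
- move=> k; rewrite /V; case: eqP => [->|_]; last case: eqP => [->|_].
  + exact: subIsetl.
  + exact: subIsetl.
  + exact: subset_refl.
- rewrite Vi Vj => -[a b] [[_ /= Aa] [_ /= Bb]].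
  by apply: ABW; split; exact: interior_subset.
Qed.

(** Finitely many pairs of indices are treated one after the other; the condition
    [i != j] allows the two sets of a pair to be shrunk independently. *)
Lemma refine_pairs (W : set (X * X)) (s : seq (I * I)) U : open W -> dense W ->
    nonempty_open_family U ->
  exists V, [/\ nonempty_open_family V, forall k, V k `<=` U k &
    forall i j, i != j -> (i, j) \in s -> V i `*` V j `<=` W].
Proof.
move=> oW dW; elim: s U => [|[i j] s IHs] U Uo; first by exists U; split => // k; exact: subset_refl.
have [V [Vo VU VW]] := IHs U Uo.
have [ij|ij] := eqVneq i j.
  exists V; split => // k l kl; rewrite inE => /orP[/eqP[ki lj]|]; last exact: VW.
  by move: kl; rewrite ki lj ij eqxx.
have [V' [V'o V'V V'W]] := refine_pair oW dW ij Vo.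
exists V'; split => // [k|k l kl]; first exact: subset_trans (V'V k) (VU k).
rewrite inE => /orP[/eqP[-> ->] //|/(VW _ _ kl)].
by apply: subset_trans => -[a b] [/= /V'V ? /V'V ?].
Qed.

End Refinement.

(** Prefixes are reversed so that the last digit is at the head and the parent of
    a word is its tail. *)
Fixpoint prefix_rev (s : nat -> bool) n : seq bool :=
  if n is m.+1 then s m :: prefix_rev s m else [::].

Lemma size_prefix_rev s n : size (prefix_rev s n) = n.
Proof. by elim: n => //= n ->. Qed.

Lemma prefix_revP s s' n :
  prefix_rev s n = prefix_rev s' n <-> forall i, (i < n)%N -> s i = s' i.
Proof.
elim: n => [|n IHn] //=; split=> [[sn /IHn ss'] i|ss'].
  by rewrite ltnS leq_eqVlt => /orP[/eqP-> //|]; exact: ss'.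
by congr cons; [exact: ss'|apply/IHn => i /ltnW; exact: ss'].
Qed.

Section CantorScheme.
Context {R : realType} {X : topologicalType} {D : X -> X -> R}.
Hypotheses (D_compat : compatible_metric D) (D_complete : complete_metric D).
Variables (W : nat -> set (X * X)) (O : nat -> set X).
Hypotheses (W_open : forall n, open (W n)) (W_dense : forall n, dense (W n)).
Hypothesis O_open : forall j, open (O j) /\ O j !=set0.

Definition node : Type := (nat * seq bool)%type.

Definition nodes_upto n : seq node :=
  [seq (j, tval t) | j <- iota 0 n.+1, t <- enum {: n.-tuple bool}].

Lemma mem_nodes_upto n j s : (j <= n)%N -> size s = n -> (j, s) \in nodes_upto n.
Proof.
move=> jn sn; apply/allpairsP; have st : size s == n by rewrite sn.
by exists (j, Tuple st); split; rewrite ?mem_iota ?mem_enum.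
Qed.

(** [W n] is imposed at level [n.+1] on finitely many words only, those of length
    [n.+1] in the first [n.+2] trees; any two distinct branches are eventually
    among them. *)
Lemma cantor_scheme : exists U : nat -> node -> set X,
  [/\ forall j s, U 0%N (j, s) = O j,
      forall n, nonempty_open_family (U n),
      forall n j b s, closure (U n.+1 (j, b :: s)) `<=` U n (j, s),
      forall n a y z, U n.+1 a y -> U n.+1 a z -> D y z < n.+1%:R^-1 &
      forall n a b, a \in nodes_upto n.+1 -> b \in nodes_upto n.+1 -> a != b ->
        U n.+1 a `*` U n.+1 b `<=` W n].
Proof.
have /choice[f fP] (nU : nat * (node -> set X)) : exists V : node -> set X,
    nonempty_open_family nU.2 ->
    [/\ nonempty_open_family V,
      forall j b s, closure (V (j, b :: s)) `<=` nU.2 (j, s),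
      forall a y z, V a y -> V a z -> D y z < nU.1.+1%:R^-1 &
      forall a b, a \in nodes_upto nU.1.+1 -> b \in nodes_upto nU.1.+1 ->
        a != b -> V a `*` V b `<=` W nU.1].
  case: nU => n U /=.
  have [Uo|nUo] := pselect (nonempty_open_family U); last by exists U.
  have [V [Vo VU VW]] := refine_pairs
    [seq (a, b) | a <- nodes_upto n.+1, b <- nodes_upto n.+1]
    (@W_open n) (@W_dense n) (fun a => Uo (a.1, behead a.2)).
  have n0 : 0 < n.+1%:R^-1 :> R by rewrite invr_gt0.
  have /choice[V' V'P] a := shrink_open D_compat n0 (Vo a).1 (Vo a).2.
  have V'V a : V' a `<=` V a.
    by move=> x V'x; have [_ _ + _] := V'P a; apply; exact: subset_closure.
  exists V' => _; split.
  - by move=> a; case: (V'P a).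
  - by move=> j b s x; have [_ _ + _] := V'P (j, b :: s); move=> /[apply] /VU.
  - by move=> a; case: (V'P a).
  - move=> a b an bn ab; apply: subset_trans (VW a b ab _) => [[y z] [/= /V'V ? /V'V ?] //|].
    by apply/allpairsP; exists (a, b).
pose U := fix U n := if n is m.+1 then f (m, U m) else fun a : node => O a.1.
have Uo n : nonempty_open_family (U n).
  by elim: n => [a|n /(fP (n, U n))[]] //; exact: O_open.
by exists U; split => // n; have [] := fP (n, U n) (Uo n).
Qed.

(** The sets met along a branch have closures nested one in the other and diameters
    tending to [0], so completeness provides a point in all of them. *)
Lemma scheme_branches : exists (U : nat -> node -> set X) (x : nat -> (nat -> bool) -> X),
  [/\ forall j s, O j (x j s),
      forall n j s, U n (j, prefix_rev s n) (x j s),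
      forall n a, open (U n a),
      forall n a y z, U n.+1 a y -> U n.+1 a z -> D y z < n.+1%:R^-1 &
      forall n a b, a \in nodes_upto n.+1 -> b \in nodes_upto n.+1 -> a != b ->
        U n.+1 a `*` U n.+1 b `<=` W n].
Proof.
have [U [U0 Uo Ucl Udiam UW]] := cantor_scheme.
have Uxs j s : exists x, forall n, U n (j, prefix_rev s n) x.
  pose B n := U n (j, prefix_rev s n).
  have BS n : closure (B n.+1) `<=` B n by exact: Ucl.
  have Bmono m n : (m <= n)%N -> B n `<=` B m.
    elim: n => [|n IHn]; first by rewrite leqn0 => /eqP->.
    rewrite leq_eqVlt => /orP[/eqP-> //|/IHn]; apply: subset_trans.
    exact: subset_trans (@subset_closure _ _) (BS n).
  have /choice[p pB] n : exists p, B n p by case: (Uo n (j, prefix_rev s n)).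
  have [|l pl] := D_complete (u := p).
    move=> e e0; exists (Num.bound e^-1).+1 => m n Nm Nn.
    have := Udiam (Num.bound e^-1) _ _ _ (Bmono _ _ Nm _ (pB m)) (Bmono _ _ Nn _ (pB n)).
    move=> /lt_trans; apply; rewrite invf_plt ?posrE //.
    apply: (@lt_trans _ _ (Num.bound e^-1)%:R); last by rewrite ltr_nat.
    by rewrite archi_boundP // invr_ge0 ltW.
  exists l => n; apply/BS/(limit_in_closure D_compat pl (N := n.+1)).
  by move=> m nm; apply: Bmono nm _ (pB m).
have /choice[x xP] (js : nat * (nat -> bool)) :
    exists x, forall n, U n (js.1, prefix_rev js.2 n) x by exact: Uxs.
exists U, (fun j s => x (j, s)); split => //.
- by move=> j s; rewrite -(U0 j [::]); exact: (xP (j, s) 0%N).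
- by move=> n j s; exact: (xP (j, s) n).
- by move=> n a; case: (Uo n a).
Qed.

Lemma node_prefix_neq j s j' s' : (j, s) <> (j', s') -> exists m,
  forall n, (m <= n)%N -> (j, prefix_rev s n) != (j', prefix_rev s' n) :> node.
Proof.
move=> neq; have [jj'|jj'] := eqVneq j j'; last first.
  by exists 0%N => k _; apply: contra jj' => /eqP[->].
have [i si] : exists i, s i <> s' i.
  by apply/existsNP => ss'; apply: neq; rewrite jj'; congr pair; exact: funext.
exists i.+1 => k ik; apply/eqP => -[_ /prefix_revP ss'].
exact/si/ss'.
Qed.

(** When the relations [W n] avoid the diagonal, distinct words of a tree with the
    same large enough length carry disjoint sets; these open sets recover the
    digits of a branch from its point, which makes the parametrization an
    embedding. *)
Lemma generic_branches : exists x : nat -> (nat -> bool) -> X,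
  [/\ forall j s, O j (x j s),
      forall j s j' s', (j, s) <> (j', s') ->
        forall N, exists2 n, (N <= n)%N & W n (x j s, x j' s') &
      (forall n y, ~ W n (y, y)) -> forall j, binary_embedding (x j)].
Proof.
have [U [x [xO xU Uo Udiam UW]]] := scheme_branches.
have pair_W j s j' s' n : (j <= n)%N -> (j' <= n)%N ->
    (j, prefix_rev s n.+1) != (j', prefix_rev s' n.+1) :> node ->
    U n.+1 (j, prefix_rev s n.+1) `*` U n.+1 (j', prefix_rev s' n.+1) `<=` W n.
  by move=> jn j'n; apply: UW; apply: mem_nodes_upto;
    rewrite ?size_prefix_rev ?leqW.
exists x; split=> // [j s j' s' /node_prefix_neq[m mP] N|offdiag j].
  pose n := maxn (maxn N m) (maxn j j').
  exists n; first by rewrite !(leq_max, leqnn, orTb).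
  apply: (@pair_W j s j' s'); rewrite ?(leq_max, leqnn, orbT, orTb) //.
  by apply: mP; rewrite leqW // !(leq_max, leqnn, orbT, orTb).
split=> [s A|s n].
  case: (D_compat) => _ D_top /D_top[e e0 eA].
  exists (Num.bound e^-1).+1 => s' ss'; apply: eA => /=.
  have s's := xU (Num.bound e^-1).+1 j s'.
  have {}s's : U (Num.bound e^-1).+1 (j, prefix_rev s (Num.bound e^-1).+1) (x j s').
    by rewrite (prefix_revP s s' _).2.
  apply: lt_trans (Udiam _ _ _ _ (xU _ j s) s's) _; rewrite invf_plt ?posrE //.
  apply: (@lt_trans _ _ (Num.bound e^-1)%:R); last by rewrite ltr_nat.
  by rewrite archi_boundP // invr_ge0 ltW.
pose m := maxn n j; exists (U m.+1 (j, prefix_rev s m.+1)).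
  by apply: open_nbhs_nbhs; split; [exact: Uo|exact: xU].
move=> s' s'U i lt_in.
suff /eqP/prefix_revP ss' : prefix_rev s m.+1 == prefix_rev s' m.+1.
  by apply: ss'; rewrite (leq_trans lt_in) // leqW // leq_maxl.
apply/negPn/negP => neq; apply: (offdiag m (x j s')).
apply: (@pair_W j s j s'); rewrite ?leq_maxr //; first by apply: contra neq => /eqP/(congr1 snd) ss'; apply/eqP.
Qed.

End CantorScheme.

Section Category.
Context {R : realType} {X : topologicalType} {D : X -> X -> R}.
Hypotheses (D_compat : compatible_metric D) (D_complete : complete_metric D).

(** The scheme for the relations [V n] x [X]: the first component of any pair of
    distinct branches lies in all [V n]. *)
Lemma baire_category (V : nat -> set X) :
    (forall m n, (m <= n)%N -> V n `<=` V m) ->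
    (forall n, open (V n)) -> (forall n, dense (V n)) ->
  dense (\bigcap_n V n).
Proof.
move=> V_dec Vo Vd U U0 Uo.
pose W n : set (X * X) := fst @^-1` V n.
have Wo n : open (W n) by apply: open_comp => // p _; exact: cvg_fst.
have Wd n : dense (W n).
  move=> O [p Op] Oo; have [||y [[q Oq <-] Vq]] := Vd n (fst @` O).
  - by exists p.1, p.
  - exact: fst_open.
  by exists q.
have [x [xU xW _]] := generic_branches D_compat D_complete Wo Wd
  (fun _ : nat => conj Uo U0).
exists (x 0%N (fun=> false)); split => // n _.
have [|m nm] := xW 0%N (fun=> false) 1%N (fun=> false) _ n; first by [].
exact: V_dec.
Qed.

(** Mycielski's theorem; no isolated point can exist, because dense open relations
    off the diagonal meet the square of every nonempty open set. *)
Lemma cantor_sets_of_dense_relation (W : nat -> set (X * X)) (O : nat -> set X) :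
    (forall m n, (m <= n)%N -> W n `<=` W m) ->
    (forall n, open (W n)) -> (forall n, dense (W n)) ->
    (forall n y, ~ W n (y, y)) -> (forall j, open (O j) /\ O j !=set0) ->
  exists2 K : nat -> set X, (forall j, cantor_set R (K j) /\ K j `<=` O j) &
    forall y z, (\bigcup_j K j) y -> (\bigcup_j K j) z -> y <> z ->
      forall n, W n (y, z).
Proof.
move=> W_dec Wo Wd W_diag Oo.
have [x [xO xW xE]] := generic_branches D_compat D_complete Wo Wd Oo.
exists (fun j => range (x j)) => [j|y z [j _ [s _ <-]] [j' _ [s' _ <-]] neq n].
  split; last by move=> _ [s _ <-].
  by apply: binary_embedding_cantor_set; apply: xE.
have [|m nm] := xW j s j' s' _ n; last exact: W_dec.
by move=> [jj' ss']; apply: neq; rewrite jj' ss'.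
Qed.

End Category.

(** * Level sets of the dynamics *)

(** Membership of the finitely many [i <= n] counted at [x] persists near [x]. *)
Lemma open_cnt_gt (R : realType) (X : topologicalType) (F : nat -> set X) (c : R) n :
  (forall i, open (F i)) -> open [set x | c < (cnt [set i | F i x] n)%:R].
Proof.
move=> Fo; rewrite openE => x /= cx.
have : \forall y \near x, forall i, (i <= n)%N -> F i x -> F i y.
  elim: n {cx} => [|n IHn].
    have [Fx|nFx] := pselect (F 0%N x).
      apply: filterS (open_nbhs_nbhs (conj (Fo 0%N) Fx)) => y Fy i.
      by rewrite leqn0 => /eqP->.
    by apply: nearW => y i; rewrite leqn0 => /eqP->.
  have : \forall y \near x, F n.+1 x -> F n.+1 y.
    have [Fx|nFx] := pselect (F n.+1 x); last by apply: nearW.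
    by apply: filterS (open_nbhs_nbhs (conj (Fo n.+1) Fx)).
  apply: filterS2 IHn => y IHy Fn i; rewrite leq_eqVlt => /orP[/eqP->//|].
  exact: IHy.
apply: filterS => y Fxy; apply: lt_le_trans cx _.
by rewrite ler_nat; apply: cnt_sub_le.
Qed.

Lemma denseI_open (X : topologicalType) (A B : set X) :
  open A -> dense A -> dense B -> dense (A `&` B).
Proof.
move=> oA dA dB O O0 oO; rewrite setIA; apply: dB; last exact: openI.
exact: dA.
Qed.

Lemma dense_sub (X : topologicalType) (A B : set X) :
  A `<=` B -> dense A -> dense B.
Proof.
by move=> AB dA O O0 oO; have [x [Ox Ax]] := dA O O0 oO; exists x; split => //; exact: AB.
Qed.

Section TopologicalGroup.
Context {G : topologicalGroupType}.

Lemma divl_continuous : continuous (fun p : G * G => (p.1^-1 * p.2)%g).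
Proof.
move=> p.
apply: (@continuous_comp _ _ _ (fun q : G * G => (q.1^-1, q.2)%g)
  (fun q : G * G => (q.1 * q.2)%g)); last exact: topgroup_mul_continuous.
apply: cvg_pair; last exact: cvg_snd.
apply: (@continuous_comp _ _ _ fst (fun x : G => x^-1%g)); first exact: cvg_fst.
exact: topgroup_inv_continuous.
Qed.

Lemma mulgl_continuous (x : G) : continuous (fun y : G => (x * y)%g).
Proof.
move=> y.
apply: (@continuous_comp _ _ _ (fun z : G => (x, z))
  (fun q : G * G => (q.1 * q.2)%g)); last exact: topgroup_mul_continuous.
by apply: cvg_pair; [exact: cvg_cst|exact: cvg_id].
Qed.

(** The map [(x, y) |-> x^-1 * y] is continuous, open and onto. *)
Lemma dense_divl (V : set G) :
  dense V <-> dense [set p : G * G | V (p.1^-1 * p.2)%g].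
Proof.
split=> Vd O.
  move=> [[x y] Oxy] oO.
  have [||v [/= Ov Vv]] := Vd [set v | O (x, (x * v)%g)].
  - by exists (x^-1 * y)%g; rewrite /= mulgA mulgV mul1g.
  - apply: (@open_comp _ _ (fun v : G => (x, (x * v)%g))) => // v _.
    by apply: cvg_pair; [exact: cvg_cst|exact: mulgl_continuous].
  by exists (x, (x * v)%g); split => //=; rewrite mulgA mulVg mul1g.
move=> [x Ox] oO.
have [||[y z] [/= Oyz Vyz]] := Vd [set p | O (p.1^-1 * p.2)%g].
- by exists (1%g, x) => /=; rewrite invg1 mul1g.
- by apply: open_comp => // p _; exact: divl_continuous.
by exists (y^-1 * z)%g.
Qed.

End TopologicalGroup.

(** Suppose that [x] is not far from [z]: with some density less than [delta / 2]
    of exceptions, the orbits of [x] and [z] stay within some [M] of each other.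
    Outside these exceptions, [x] at distance more than [M + M'] from [y] forces
    [y] at distance more than [M'] from [z]. *)
Lemma far_apart_split (R : realType) (G : topologicalGroupType)
    (rho : G -> G -> R) (T : G -> G) delta x y z :
    pseudometric rho -> far_apart rho T delta x y ->
  far_apart rho T (delta / 2) x z \/ far_apart rho T (delta / 2) y z.
Proof.
move=> [_ _ rho_sym rho_tri] far_xy.
have [|/existsNP[M /not_implyP[M0 /upper_density_geP/existsNP[c]]]] :=
  pselect (far_apart rho T (delta / 2) x z); first by left.
move=> /not_implyP[cd /existsNP[N Nc]]; right=> M' M'0.
apply/upper_density_geP => c' c'd N'.
have MM' : 0 < M + M' by rewrite addr_gt0.
have cc' : c + c' < delta by lra.
have /(upper_density_geP _ _).1/(_ _ cc')/(_ (maxn N N'))[n] := far_xy _ MM'.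
rewrite geq_max => /andP[Nn N'n] lt_n; exists n => //.
set A := (X in cnt X n) in lt_n.
pose B := [set i | M < rho (iter i T x) (iter i T z)].
have nB : (cnt B n)%:R <= c * n%:R.
  by rewrite leNgt; apply/negP => ?; apply: Nc; exists n.
set C := (X in cnt X n).
have ABC : A `<=` B `|` C.
  move=> i; rewrite /A /B /C /= => lt_i.
  have [|Bi] := ltP M (rho (iter i T x) (iter i T z)); first by left.
  right; have := rho_tri (iter i T x) (iter i T z) (iter i T y).
  by rewrite (rho_sym (iter i T z)); lra.
have : (cnt A n <= cnt B n + cnt C n)%N.
  exact: leq_trans (cnt_sub n ABC) (cntU _ _ _).
by rewrite -(ler_nat R) natrD; lra.
Qed.

Section Dynamics.
Context {R : realType} {G : topologicalGroupType}.
Variables (d rho : G -> G -> R) (T : {multiplicative G -> G}).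

Lemma iter_morph1 n : iter n T 1%g = 1%g.
Proof.
have T1 : T 1%g = 1%g by apply: (mulgI (T 1%g)); rewrite -gmulfM !mulg1.
by elim: n => //= n ->.
Qed.

Lemma iter_morphM n x y : iter n T (x * y)%g = (iter n T x * iter n T y)%g.
Proof. by elim: n => //= n ->; exact: gmulfM. Qed.

Lemma iter_morph_continuous n : continuous T -> continuous (iter n T).
Proof.
move=> cT; elim: n => [|n IHn] x /=; first exact: cvg_id.
by apply: (@continuous_comp _ _ _ (iter n T) T); [exact: IHn|exact: cT].
Qed.

(** Reduction of pairs to single points, the reason why left-invariant distances
    are used. *)
Lemma left_invariant_iter (q : G -> G -> R) n x y :
    left_invariant q -> pseudometric q ->
  q (iter n T x) (iter n T y) = q (iter n T (x^-1 * y)%g) 1%g.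
Proof.
move=> qL [_ _ q_sym _]; rewrite -(mulVKg x y) iter_morphM mulKg.
by rewrite -{1}[iter n T x]mulg1 qL q_sym.
Qed.

Lemma distr_proximal_divl x y : left_invariant d -> pseudometric d ->
  distr_proximal d T x y <-> distr_proximal d T (x^-1 * y)%g 1%g.
Proof.
move=> dL dp; rewrite /distr_proximal.
have E e : [set n | d (iter n T x) (iter n T y) < e] =
    [set n | d (iter n T (x^-1 * y)%g) (iter n T 1%g) < e].
  by apply/seteqP; split => n /=; rewrite iter_morph1 -left_invariant_iter.
by split=> P e /P; rewrite E.
Qed.

Lemma far_apart_divl delta x y : left_invariant rho -> pseudometric rho ->
  far_apart rho T delta x y <-> far_apart rho T delta (x^-1 * y)%g 1%g.
Proof.
move=> dL dp; rewrite /far_apart.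
have E M : [set n | M < rho (iter n T x) (iter n T y)] =
    [set n | M < rho (iter n T (x^-1 * y)%g) (iter n T 1%g)].
  by apply/seteqP; split => n /=; rewrite iter_morph1 -left_invariant_iter.
by split=> P M /P; rewrite E.
Qed.

(** Both families decrease with [k], and their intersections are the points
    proximal to the identity and, up to lowering [delta], the points [delta]-far
    from it. *)
Definition prox_level (k : nat) : set G :=
  \bigcup_(n in [set n | (k <= n)%N])
    [set x | (1 - k.+1%:R^-1 : R) * n%:R <
             (cnt [set i | d (iter i T x) 1%g < k.+1%:R^-1] n)%:R].

Definition far_level (delta : R) (k : nat) : set G :=
  \bigcup_(n in [set n | (k <= n)%N])
    [set x | delta * n%:R <
             (cnt [set i | k.+1%:R < rho (iter i T x) 1%g] n)%:R].

Lemma prox_level_dec j k : (j <= k)%N -> prox_level k `<=` prox_level j.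
Proof.
move=> jk x [n kn lt_n]; exists n; first exact: leq_trans kn.
have kj : k.+1%:R^-1 <= j.+1%:R^-1 :> R by rewrite lef_pV2 ?posrE // ler_nat.
apply: (@le_lt_trans _ _ ((1 - k.+1%:R^-1) * n%:R)); first by rewrite ler_wpM2r // lerD2l lerN2.
apply: lt_le_trans lt_n _; rewrite ler_nat; apply: cnt_sub => i /= /lt_le_trans.
exact.
Qed.

Lemma far_level_dec delta j k : (j <= k)%N -> far_level delta k `<=` far_level delta j.
Proof.
move=> jk x [n kn lt_n]; exists n; first exact: leq_trans kn.
apply: lt_le_trans lt_n _; rewrite ler_nat; apply: cnt_sub => i /=.
by apply: le_lt_trans; rewrite ler_nat.
Qed.

Lemma prox_level_open k : compatible_metric d -> continuous T -> open (prox_level k).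
Proof.
move=> dc cT; apply: bigcup_open => n _.
apply: (@open_cnt_gt R G (fun i => [set x | d (iter i T x) 1%g < k.+1%:R^-1])) => i.
have -> : [set x | d (iter i T x) 1%g < k.+1%:R^-1] =
    iter i T @^-1` [set y | d 1%g y < k.+1%:R^-1].
  by case: dc => -[[_ _ d_sym _] _] _; apply/seteqP; split => x /=; rewrite d_sym.
apply: open_comp; last exact: open_metric_ball.
by move=> x _; exact: iter_morph_continuous.
Qed.

Lemma far_level_open delta k :
    continuous (fun p : G * G => rho p.1 p.2) -> continuous T ->
  open (far_level delta k).
Proof.
move=> rho_c cT; apply: bigcup_open => n _.
apply: (@open_cnt_gt R G (fun i => [set x | k.+1%:R < rho (iter i T x) 1%g])) => i.
apply: (@open_comp _ _ (fun x => rho (iter i T x) 1%g) [set r | k.+1%:R < r]); last exact: open_gt.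
move=> x _.
apply: (@continuous_comp _ _ _ (fun x => (iter i T x, 1%g)) (fun p : G * G => rho p.1 p.2)); last exact: rho_c.
by apply: cvg_pair; [exact: iter_morph_continuous|exact: cvg_cst].
Qed.

Lemma distr_proximal_levelP x :
  distr_proximal d T x 1%g <-> forall k, prox_level k x.
Proof.
split=> [Px k|Px e e0].
  have e0 : 0 < k.+1%:R^-1 :> R by rewrite invr_gt0.
  have lt1 : 1 - k.+1%:R^-1 < 1 :> R by rewrite ltrBlDr ltrDl.
  have /(upper_density_eq1P _).1/(_ _ lt1)/(_ k)[n kn] := Px _ e0.
  under [X in cnt X n]eq_set do rewrite iter_morph1.
  by exists n.
apply/upper_density_eq1P => c c1 N.
have [k1 k1P] := natSV_lt e0.
have [|k2 k2P] := @natSV_lt R (1 - c); first by rewrite subr_gt0.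
pose k := maxn N (maxn k1 k2).
have [n kn lt_n] := Px k.
have ke : k.+1%:R^-1 < e by apply: k1P; rewrite !(leq_max, leqnn, orbT, orTb).
have kc : k.+1%:R^-1 < 1 - c by apply: k2P; rewrite !(leq_max, leqnn, orbT, orTb).
exists n; first by apply: leq_trans kn; exact: leq_maxl.
apply: (@le_lt_trans _ _ ((1 - k.+1%:R^-1) * n%:R)).
  by rewrite ler_wpM2r // lerBrDl -lerBrDr ltW.
apply: lt_le_trans lt_n _; rewrite ler_nat; apply: cnt_sub => i /=.
by rewrite iter_morph1 => /lt_trans; apply.
Qed.

Lemma far_apart_level delta c x k : c < delta ->
  far_apart rho T delta x 1%g -> far_level c k x.
Proof.
move=> cd Fx; have k0 : 0 < k.+1%:R :> R by [].
have /(upper_density_geP _ _).1/(_ _ cd)/(_ k)[n kn] := Fx _ k0.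
by under [X in cnt X n]eq_set do rewrite iter_morph1; exists n.
Qed.

Lemma far_levels_far_apart delta x :
  (forall k, far_level delta k x) -> far_apart rho T delta x 1%g.
Proof.
move=> Fx M M0; apply/upper_density_geP => c cd N.
pose k := maxn N (Num.bound M); have [n kn lt_n] := Fx k.
exists n; first by apply: leq_trans kn; exact: leq_maxl.
apply: (@le_lt_trans _ _ (delta * n%:R)); first by rewrite ler_wpM2r // ltW.
apply: lt_le_trans lt_n _; rewrite ler_nat; apply: cnt_sub => i /=.
rewrite iter_morph1; apply: lt_trans.
apply: (@lt_le_trans _ _ (Num.bound M)%:R); first by rewrite archi_boundP // ltW.
by rewrite ler_nat leqW // leq_maxr.
Qed.

(** This moves a far point to an iterate close to the identity. *)
Lemma far_apart_iter delta m x :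
  far_apart rho T delta x 1%g -> far_apart rho T delta (iter m T x) 1%g.
Proof.
move=> Fx M M0; apply/upper_density_geP => c cd.
have cd2 : (c + delta) / 2 < delta by lra.
have /(upper_density_geP _ _).1/(_ _ cd2) := Fx _ M0.
apply: (@frequent_finite_defect R _ _ m); first by lra.
move=> n; apply: leq_trans (cnt_shift _ m n) _; rewrite leq_add2r.
by apply: cnt_sub => i /=; rewrite !iter_morph1 addnC iterD.
Qed.

(** A single set of times replaces the family of conditions indexed by [e] or [M]:
    this is the diagonalization, applied once to the proximity times and once to
    the far times. *)
Lemma distr_irregular2P x : compatible_metric d ->
  distr_irregular2 rho T x <->
  distr_proximal d T x 1%g /\
  exists2 delta, 0 < delta & far_apart rho T delta x 1%g.
Proof.
move=> dc; have d_sym y z : d y z = d z y by case: dc => -[[]].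
split=> [[[A [A1 Ax]] [B [/upper_density_gt0P[c c0 Bc] Bx]]]|[Px [delta delta0 Fx]]].
  split=> [e e0|].
    apply/upper_density_eq1P => r r1.
    have r2 : (r + 1) / 2 < 1 by lra.
    have Ar := (upper_density_eq1P _).1 A1 _ r2.
    apply: (frequent_eventually_sub _ _ Ar); first by lra.
    have An : \forall n \near \oo, A n -> d 1%g (iter n T x) < e.
      by apply: (Ax [set y | d 1%g y < e]); exact: nbhs_metric_ball.
    apply: filterS An => n An Ann /=; rewrite iter_morph1 d_sym; exact: An.
  exists c => // M M0; apply/upper_density_geP => r rc.
  apply: (frequent_eventually_sub rc _ Bc).
  have Bn : \forall n \near \oo, B n -> M < rho (iter n T x) 1%g.
    by have /cvgryPgt/(_ M) := Bx.
  by apply: filterS Bn => n Bn Bnn /=; rewrite iter_morph1; exact: Bn.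
split.
  have [|k|A [A_sub A_freq]] := @frequent_pseudo_intersection R
    (fun k => [set i | d (iter i T x) 1%g < k.+1%:R^-1])
    (fun k => 1 - k.+1%:R^-1).
  - by move=> k i /= /lt_le_trans; apply; rewrite lef_pV2 ?posrE // ler_nat.
  - have k0 : 0 < k.+1%:R^-1 :> R by rewrite invr_gt0.
    have := Px _ k0; under eq_set do rewrite iter_morph1.
    by move=> /upper_density_eq1P; apply; rewrite ltrBlDr ltrDl.
  exists A; split.
    apply/upper_density_eq1P => c c1 N.
    have [|k1 k1P] := @natSV_lt R (1 - c); first by rewrite subr_gt0.
    have [n kn lt_n] := A_freq (maxn N k1).
    exists n; first by apply: leq_trans kn; exact: leq_maxl.
    apply: le_lt_trans lt_n; rewrite ler_wpM2r // lerBrDl -lerBrDr ltW //.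
    by apply: k1P; exact: leq_maxr.
  move=> V; case: (dc) => _ d_top /d_top[e e0 eV].
  have [k kP] := natSV_lt e0; have [N NP] := A_sub k.
  exists N.+1 => // n /= Nn An; apply: eV => /=; rewrite d_sym.
  exact: lt_trans (NP _ Nn An) (kP _ (leqnn _)).
have [|k|B [B_sub B_freq]] := @frequent_pseudo_intersection R
  (fun k => [set i | k.+1%:R < rho (iter i T x) 1%g]) (fun=> delta / 2).
- by move=> k i /=; apply: le_lt_trans; rewrite ler_nat.
- have := Fx k.+1%:R (ltr0Sn _ _); under eq_set do rewrite iter_morph1.
  by move=> /upper_density_geP; apply; lra.
exists B; split.
  by apply/upper_density_gt0P; exists (delta / 2); [lra|exact: B_freq].
apply/cvgryPgt => M; have [N NP] := B_sub (Num.bound `|M|).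
exists N.+1 => // n /= Nn Bn; apply: le_lt_trans (NP _ Nn Bn).
rewrite (le_trans (ler_norm _)) // (@le_trans _ _ (Num.bound `|M|)%:R) ?ler_nat //.
by rewrite ltW // archi_boundP.
Qed.

Lemma prox_far_irregular delta x : compatible_metric d -> 0 < delta ->
    (forall k, prox_level k x) -> (forall k, far_level delta k x) ->
  distr_irregular2 rho T x.
Proof.
move=> dc delta0 /distr_proximal_levelP Px /far_levels_far_apart Fx.
by apply/distr_irregular2P => //; split => //; exists delta.
Qed.

End Dynamics.

(** * The equivalence *)

Section Equivalence.
Context {R : realType} {G : topologicalGroupType}.
Variables (d rho : G -> G -> R) (T : {multiplicative G -> G}).
Hypotheses (G_complete : completely_metrizable R G) (dc : compatible_metric d)
  (dL : left_invariant d) (rho_p : pseudometric rho) (rhoL : left_invariant rho)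
  (rho_c : continuous (fun p : G * G => rho p.1 p.2)) (cT : continuous T).

Let dp : pseudometric d. Proof. by case: dc => -[]. Qed.

(** The common reformulation of the four assertions. *)
Definition generic_instability := exists2 delta : R, 0 < delta &
  forall k, dense (prox_level d T k `&` far_level rho T delta k).

(** One irregular point [x0] yields the instability of every [x]: the iterates of
    [x0] near the identity, translated by [x], provide the points [y]. *)
Lemma irregular_dense_proximal_unstable :
  (exists2 S : set G, dense S & S `<=` [set x | distr_irregular2 rho T x]) ->
  dense (distr_proximal_relation d T) /\ extremely_mean_L_unstable d rho T.
Proof.
move=> [S Sd SI]; split.
  have /dense_divl : dense [set x | distr_proximal d T x 1%g].
    by apply: dense_sub Sd => x /SI/(distr_irregular2P _ _ _ dc)[].
  by apply: dense_sub => p Pp /=; apply/distr_proximal_divl.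
have [||x0 [_ /SI/(distr_irregular2P _ _ _ dc)[Px [delta delta0 Fx]]]] := Sd setT.
- by exists 1%g.
- exact: openT.
exists delta => // x e e0.
have lt12 : 1 / 2 < 1 :> R by lra.
have /(upper_density_eq1P _).1/(_ _ lt12)/(_ 0%N)[n _ lt_n] := Px e e0.
have [i] : [set i | d (iter i T x0) (iter i T 1%g) < e] !=set0.
  apply: (@cnt_gt0 _ n); rewrite -(ltr_nat R); apply: le_lt_trans lt_n.
  by rewrite mulr_ge0 //; lra.
rewrite /= iter_morph1 => di; exists (x * iter i T x0)%g.
  by rewrite -{1}[x]mulg1 dL; case: dp => _ _ -> _.
by apply/far_apart_divl => //; rewrite mulKg; exact: far_apart_iter.
Qed.

(** The factor [1 / 4] is [1 / 2], from [far_apart_split], halved again to get a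
    strict inequality at finite times. *)
Lemma proximal_unstable_generic :
  dense (distr_proximal_relation d T) /\ extremely_mean_L_unstable d rho T ->
  generic_instability.
Proof.
move=> [Pd [delta delta0 unst]]; exists (delta / 4); first by lra.
move=> k; apply: denseI_open; first exact: prox_level_open.
  have : dense [set x | distr_proximal d T x 1%g].
    by apply/dense_divl; apply: dense_sub Pd => p Pp /=; exact: (distr_proximal_divl T p.1 p.2 dL dp).1.
  by apply: dense_sub => x /= /distr_proximal_levelP.
have lt42 : delta / 4 < delta / 2 by lra.
move=> O [z Oz] oO; have [e e0 eO] := metric_ball_sub dc oO Oz.
have [y zy Fzy] := unst z e e0.
have [Fz|Fy] := far_apart_split 1%g rho_p Fzy.
  by exists z; split => //; exact: far_apart_level lt42 Fz.
by exists y; split; [exact: eO|exact: far_apart_level lt42 Fy].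
Qed.

Let V delta k : set G := prox_level d T k `&` far_level rho T delta k.

Let V_dec delta m n : (m <= n)%N -> V delta n `<=` V delta m.
Proof.
by move=> mn x [Px Fx]; split; [exact: prox_level_dec Px|exact: far_level_dec Fx].
Qed.

Let V_open delta n : open (V delta n).
Proof. by apply: openI; [exact: prox_level_open|exact: far_level_open]. Qed.

Lemma generic_residual : generic_instability ->
  exists2 S : set G, residual S & S `<=` [set x | distr_irregular2 rho T x].
Proof.
move=> [delta delta0 Vd]; have [D [D_compat D_complete]] := G_complete.
exists (\bigcap_k V delta k).
  exists (\bigcap_k V delta k); split => //; first by exists (V delta).
  exact: baire_category D_compat D_complete _ (@V_dec delta) (@V_open delta) Vd.
move=> x Vx; apply: (prox_far_irregular dc delta0) => k.
  by case: (Vx k I).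
by case: (Vx k I).
Qed.

Lemma generic_scrambled : generic_instability ->
  exists2 delta : R, 0 < delta &
    forall O : nat -> set G, (forall j, open (O j) /\ O j !=set0) ->
      exists2 K : nat -> set G,
        (forall j, cantor_set R (K j) /\ K j `<=` O j) &
        distr_extremely_scrambled2 d rho T delta (\bigcup_j K j).
Proof.
move=> [delta delta0 Vd]; have [D [D_compat D_complete]] := G_complete.
exists delta => // O Oo.
pose W k : set (G * G) := [set p | V delta k (p.1^-1 * p.2)%g].
have [| | |n y [_ [m _ /=]]|K KO KW] := cantor_sets_of_dense_relation D_compat D_complete (W := W) _ _ _ _ Oo.
- by move=> m n mn p; exact: V_dec.
- by move=> n; apply: open_comp => // p _; exact: divl_continuous.
- by move=> n; exact: ((dense_divl (V delta n)).1 (Vd n)).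
(* Off the diagonal: the identity is never at positive distance from itself. *)
- rewrite mulVg ltNge => /negP; apply.
  rewrite (_ : cnt _ m = 0%N) ?mulr_ge0 // ?ltW //.
  apply/eqP; rewrite -leqn0 leqNgt; apply/negP => /cnt_gt0[i /=].
  by rewrite iter_morph1; case: rho_p => _ -> _ _; rewrite ltrn0.
exists K => // y z Ky Kz yz; split.
  apply/distr_proximal_divl => //; apply/distr_proximal_levelP => k.
  by case: (KW y z Ky Kz yz k).
apply/far_apart_divl => //; apply: far_levels_far_apart => k.
by case: (KW y z Ky Kz yz k).
Qed.

Lemma scrambled_proximal_unstable :
  (exists2 delta : R, 0 < delta &
    forall O : nat -> set G, (forall j, open (O j) /\ O j !=set0) ->
      exists2 K : nat -> set G,
        (forall j, cantor_set R (K j) /\ K j `<=` O j) &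
        distr_extremely_scrambled2 d rho T delta (\bigcup_j K j)) ->
  dense (distr_proximal_relation d T) /\ extremely_mean_L_unstable d rho T.
Proof.
move=> [delta delta0 scr]; have [_ d_refl _ _] := dp; split.
  move=> O [[y z] Oyz] oO.
  have : nbhs (y, z) O by exact: open_nbhs_nbhs.
  case=> -[A B] /= [Ay Bz] ABO.
  have [|K KO KS] := scr (fun j => if j is 0%N then A^° else B^°).
    by case=> [|j]; split; [exact: open_interior|exists y|exact: open_interior|exists z].
  have [/cantor_set_two_points[a [a' [Ka Ka' aa']]] K0] := KO 0%N.
  have [/cantor_set_two_points[b [_ [Kb _ _]]] K1] := KO 1%N.
  (* [K 0] and [K 1] may intersect, hence the choice between two points of [K 0]. *)
  have [c Kc cb] : exists2 c, K 0%N c & c <> b.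
    have [ab|ab] := pselect (a = b); last by exists a.
    by exists a' => // a'b; apply: aa'; rewrite ab a'b.
  exists (c, b); split.
    by apply: ABO; split => /=; apply: interior_subset; [exact: K0|exact: K1].
  by have [] := KS c b _ _ cb; [exists 0%N|exists 1%N|].
exists (delta / 2); first by lra.
move=> x e e0; have [|K KO KS] := scr (fun=> [set y | d x y < e]).
  by move=> _; split; [exact: open_metric_ball|exists x; rewrite /= d_refl].
have [/cantor_set_two_points[a [b [Ka Kb ab]]] K0] := KO 0%N.
have [||_ Fab] := KS a b _ _ ab; [by exists 0%N|by exists 0%N|].
have [_ _ rho_sym _] := rho_p.
have far_sym y z : far_apart rho T (delta / 2) y z -> far_apart rho T (delta / 2) z y.
  move=> F M /F; under eq_set do rewrite rho_sym; exact.
by have [/far_sym Fa|/far_sym Fb] := far_apart_split x rho_p Fab;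
  [exists a|exists b] => //; exact: K0.
Qed.

End Equivalence.

Theorem theorem5p26 (R : realType) (G : topologicalGroupType)
    (d rho : G -> G -> R) (T : {multiplicative G -> G})
    (G_completely_metrizable : completely_metrizable R G)
    (d_compatible : compatible_metric d)
    (d_left_invariant : left_invariant d)
    (rho_pseudometric : pseudometric rho)
    (rho_left_invariant : left_invariant rho)
    (rho_continuous : continuous (fun p : G * G => rho p.1 p.2))
    (T_continuous : continuous T) :
  [<->
    exists2 S : set G, dense S & S `<=` [set x | distr_irregular2 rho T x];
    exists2 S : set G, residual S & S `<=` [set x | distr_irregular2 rho T x];
    exists2 delta : R, 0 < delta &
      forall O : nat -> set G, (forall j, open (O j) /\ O j !=set0) ->
        exists2 K : nat -> set G,
          (forall j, cantor_set R (K j) /\ K j `<=` O j) &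
          distr_extremely_scrambled2 d rho T delta (\bigcup_j K j);
    dense (distr_proximal_relation d T) /\ extremely_mean_L_unstable d rho T].
Proof.
have irregular_unstable := irregular_dense_proximal_unstable d_compatible
  d_left_invariant rho_pseudometric rho_left_invariant.
have unstable_generic := proximal_unstable_generic d_compatible
  d_left_invariant rho_pseudometric T_continuous.
have generic_residual_set := generic_residual G_completely_metrizable
  d_compatible rho_continuous T_continuous.
have residual_dense :
    (exists2 S : set G, residual S & S `<=` [set x | distr_irregular2 rho T x]) ->
    exists2 S : set G, dense S & S `<=` [set x | distr_irregular2 rho T x].
  by move=> [S [A [_ Ad AS]] SI]; exists A => // x /AS/SI.
(* The construction of Cantor sets starts from the generic open sets, which are
   recovered from a residual set through the first and fourth assertions. *)
tfae.
- by move=> /irregular_unstable/unstable_generic/generic_residual_set.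
- move=> /residual_dense/irregular_unstable/unstable_generic.
  exact: generic_scrambled.
- exact: scrambled_proximal_unstable.
- by move=> /unstable_generic/generic_residual_set/residual_dense.
Qed.
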